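(* For every integer $n \ge 3$, \[ \mathcal{F}_{T_n} \le \mathcal{F}_{R_n} \le \binom{n}{2}\, \mathcal{F}_{P_n}. \]
   Context: All graphs are finite and simple. For a graph $G$, a fort is a nonempty set $F \subseteq V(G)$ such that every vertex outside $F$ is adjacent to either zero or at least two vertices of $F$. A fort is minimal if no proper subset of it is a fort. $\mathcal{F}_G$ denotes the number of minimal forts of $G$. $\mathcal{F}_{T_n}$ is the maximum of $\mathcal{F}_T$ over all trees $T$ on $n$ vertices, $\mathcal{F}_{R_n}$ is the maximum of $\mathcal{F}_R$ over all forests $R$ on $n$ vertices, and $\mathcal{F}_{P_n}$ is the number of minimal forts of the path $P_n$ on $n$ vertices (equivalently, $\mathcal{F}_{P_n}=a_n$ where $a_1=a_2=a_3=1$ and $a_n=a_{n-2}+a_{n-3}$ for $n\ge4$). *)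

(* Defs.v *)
From mathcomp Require Import all_boot.
From mathcomp Require Import boolp.

Set Implicit Arguments.
Unset Strict Implicit.
Unset Printing Implicit Defensive.

Definition graph (n : nat) := {set ('I_n * 'I_n)}.

Definition adj n (g : graph n) : rel 'I_n := fun u v => (u, v) \in g.

Definition simple_graph n (g : graph n) : bool :=
  [forall u : 'I_n, forall v : 'I_n, adj g u v == adj g v u]
  && [forall u : 'I_n, ~~ adj g u u].

Definition has_cycle n (g : graph n) : Prop :=
  exists (x : 'I_n) (p : seq 'I_n),
    [/\ path (adj g) x p, uniq (x :: p), 2 <= size p & adj g (last x p) x].

Definition is_forest n (g : graph n) : bool :=
  simple_graph g && `[< ~ has_cycle g >].

Definition is_tree n (g : graph n) : bool :=
  is_forest g && [forall u : 'I_n, forall v : 'I_n, connect (adj g) u v].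

Definition is_fort n (g : graph n) (F : {set 'I_n}) : bool :=
  (F != set0) &&
  [forall v : 'I_n, (v \notin F) ==> (#|[set u in F | adj g v u]| != 1)].

Definition is_minimal_fort n (g : graph n) (F : {set 'I_n}) : bool :=
  is_fort g F && [forall F' : {set 'I_n}, (F' \proper F) ==> ~~ is_fort g F'].

Definition nb_min_forts n (g : graph n) : nat :=
  #|[set F : {set 'I_n} | is_minimal_fort g F]|.

Definition FT (n : nat) : nat := \max_(g : graph n | is_tree g) nb_min_forts g.
Definition FR (n : nat) : nat := \max_(g : graph n | is_forest g) nb_min_forts g.

Definition path_graph (n : nat) : graph n :=
  [set uv : 'I_n * 'I_n | (uv.1.+1 == uv.2 :> nat) || (uv.2.+1 == uv.1 :> nat)].

Definition FP (n : nat) : nat := nb_min_forts (path_graph n).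

(* Main.v *)
Require Import Defs.
From mathcomp Require Import all_boot.
From mathcomp Require Import boolp zify.

Set Implicit Arguments.
Unset Strict Implicit.
Unset Printing Implicit Defensive.

(** In a forest, a minimal fort is either an isolated vertex or contains two
leaves, so it suffices to show that for fixed leaves [u] and [v] of a forest on
[n] vertices at most [a_n] minimal forts contain both, [a] being the Padovan
sequence.  If a vertex [x] has two neighbours in a minimal fort [F], then [F]
lies in the two branches at [x] through these neighbours; hence [F] is connected
through distance-two steps and, after rooting the tree at [u], is described by
local conditions relating each vertex to its parent and grandparent.  Such sets
are counted by pruning.  Let [l] be a deepest vertex off the path from [u] to
[v], and [c] its parent.  If [c] is on the path, [l] can be deleted.  If [l] is
the only child of [c], either [c] is out of [F] and [{l, c}] can be deleted, or
[c] is in [F] and [{l, c, parent of c}] can: [a_n = a_(n-2) + a_(n-3)].  If [c]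
has [k >= 2] children, all leaves, [F] contains at most one of them; this is
settled by [2 a_j <= a_(j+3)], by [3 a_j <= a_(j+4)] (which fails for [j = 4], where
an antichain argument takes over), and by [a_n = a_(n-1) + a_(n-5)] for [k >= 4].
Finally the path on [n] vertices has at least [a_n] minimal forts. *)

(** * The Padovan sequence *)

(** The value 0 at 0 starts the recurrence at 3 and is the right bound for an empty vertex set. *)
Fixpoint pad (n : nat) : nat :=
  match n with
  | 0 => 0
  | 1 | 2 => 1
  | (m.+1 as q).+2 => pad q + pad m
  end.

Lemma padS3 n : pad n.+3 = pad n.+1 + pad n.
Proof. by []. Qed.

Lemma nat_ind3 (P : nat -> Prop) :
  P 0 -> P 1 -> P 2 -> (forall n, P n -> P n.+1 -> P n.+2 -> P n.+3) ->
  forall n, P n.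
Proof.
move=> P0 P1 P2 PS n; suff [] : [/\ P n, P n.+1 & P n.+2] by [].
by elim: n => [|n [? ? ?]]; split=> //; exact: PS.
Qed.

Lemma pad_leS n : pad n <= pad n.+1.
Proof.
elim/nat_ind3: n => // n h0 h1 _.
by have := padS3 n; have := padS3 n.+1; lia.
Qed.

Lemma leq_pad m n : m <= n -> pad m <= pad n.
Proof. exact: (homo_leq (@leqnn) leq_trans pad_leS). Qed.

Lemma pad_gt0 n : 0 < n -> 0 < pad n.
Proof. exact: (@leq_pad 1). Qed.

Lemma padS5 n : pad n.+4.+1 = pad n.+4 + pad n.
Proof. by have := padS3 n; have := padS3 n.+1; have := padS3 n.+2; lia. Qed.

Lemma pad_double n : pad n + pad n <= pad n.+3.
Proof. by have := padS3 n; have := pad_leS n; lia. Qed.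

(** The inequality passes through the recurrence, so the cases 5, 6, 7 carry all larger ones; 2 and
    3 are computed, and 4 would require 6 <= 5. *)
Lemma pad_triple n : 2 <= n -> n != 4 -> 3 * pad n <= pad n.+4.
Proof.
case: n => [|[|[|[|[|n]]]]] // _ _.
elim/nat_ind3: n => // n h0 h1 _.
by have := padS3 n.+4.+1; have := padS3 n.+4.+4.+1; lia.
Qed.

(** * Counting rooted forts *)

Lemma leq_card_bigcup (I T : finType) (P : {set I}) (S : I -> {set T}) :
  #|\bigcup_(i in P) S i| <= \sum_(i in P) #|S i|.
Proof.
elim/big_rec2: _ => [|i n X _ IH]; first by rewrite cards0.
by apply: leq_trans (leq_card_setU _ _).1 _; rewrite leq_add2l.
Qed.

Lemma cards_setD2 (T : finType) (A : {set T}) x y :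
  x \in A -> y \in A -> x != y -> #|A :\: (x |: [set y])|.+2 = #|A|.
Proof.
move=> xA yA xy; have sA : x |: [set y] \subset A by rewrite subUset !sub1set xA.
have := subset_leq_card sA; rewrite (cardsDS sA) cards2 xy; lia.
Qed.

Lemma cards_setD3 (T : finType) (A : {set T}) x y z :
  x \in A -> y \in A -> z \in A -> x != y -> x != z -> y != z ->
  #|A :\: [set x; y; z]|.+3 = #|A|.
Proof.
move=> xA yA zA xy xz yz.
have sA : [set x; y; z] \subset A by rewrite !subUset !sub1set xA yA.
have := subset_leq_card sA; rewrite (cardsDS sA) setUC cardsU1 cards2 xy.
by rewrite !inE negb_or !(eq_sym z) xz yz; lia.
Qed.

Lemma proper_setD (T : finType) (A B : {set T}) x :
  x \in A -> x \in B -> A :\: B \proper A.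
Proof.
move=> xA xB; apply: sub_proper_trans (properD1 xA).
by apply: setDS; rewrite sub1set.
Qed.

Lemma card_set_split (T : finType) (S : {set T}) (P : pred T) :
  #|[set x in S | P x]| + #|[set x in S | ~~ P x]| = #|S|.
Proof.
rewrite -(cardsID [set x | P x] S); congr (_ + _); apply: eq_card => x.
  by rewrite !inE.
by rewrite !inE andbC.
Qed.

Section RootedForts.
Variables (V : finType) (u : V) (par : V -> V) (d : V -> nat).
Hypothesis par_root : par u = u.
Hypothesis depthS : forall x, x != u -> d x = (d (par x)).+1.

(* The traces on [A] of the minimal forts containing the root [u] and [v]: a
fort has no vertex with two children in it, and climbing from one of its
vertices, exactly one of the next two ancestors belongs to it.  [A] need not be
closed under [par]: a vertex of [A] whose parent is not in [A] cannot belong to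
[F], and neither can its descendants. *)
Record rfort (v : V) (A F : {set V}) : Prop := RFort {
  rf_sub : F \subset A;
  rf_root : u \in F;
  rf_mark : v \in F;
  rf_par : forall y, y \in F -> par y \in A;
  rf_inj : forall y z, y \in F -> z \in F -> y != u -> z != u ->
    par y = par z -> y = z;
  rf_up : forall y, y \in F -> y != u -> par y \notin F -> par (par y) \in F;
  rf_alone : forall y, y \in F -> y != u -> par y \in F -> par y != u ->
    par (par y) \notin F;
  rf_down : forall x, x \in A -> x \notin F -> par x \in F ->
    exists2 y, y \in F & y != u /\ par y = x }.

Definition rforts v A := [set F | `[< rfort v A F >]].

Lemma rfortsP v A F : reflect (rfort v A F) (F \in rforts v A).
Proof. by rewrite inE; exact: asboolP. Qed.

Lemma depth_par x : x != u -> d (par x) < d x.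
Proof. by move=> /depthS ->. Qed.

Lemma par_neq x : x != u -> par x != x.
Proof. by move=> /depth_par; apply: contraTneq => ->; rewrite ltnn. Qed.

Lemma par_neq_root y x : x != u -> par y = x -> y != u.
Proof. by move=> xu yx; apply: contraNneq xu => yu; rewrite -yx yu par_root. Qed.

(** Every condition looks from a vertex at most to its parent, its grandparent or a child in [F],
    and [B] retains these. The mark may change to [w], as is needed when the end [v] of the path is
    itself deleted. *)
Lemma rfort_restrict v w (A B F : {set V}) :
  rfort v A F -> B \subset A -> u \in B -> w \in F -> w \in B ->
  (forall y, y \in F -> y \in B -> par y \in B) ->
  (forall y, y \in F -> y \in B -> y != u -> par (par y) \in B) ->
  (forall x y, x \in B -> x \notin F -> y \in F -> par y = x -> y \in B) ->
  rfort w B (F :&: B).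
Proof.
move=> [FA uF vF pA inj up alone down] BA uB wF wB c1 c3 c2.
split; rewrite ?in_setI ?uF ?wF ?subsetIr //.
- by move=> y /setIP[yF yB]; exact: c1.
- by move=> y z /setIP[yF _] /setIP[zF _] yu zu /(inj _ _ yF zF yu zu).
- move=> y /setIP[yF yB] yu; rewrite !in_setI (c1 _ yF yB) andbT => pF.
  by rewrite up //= c3.
- move=> y /setIP[yF yB] yu; rewrite !in_setI => /andP[pF pB] pu.
  by rewrite (negPf (alone _ yF yu pF pu)).
- move=> x xB; rewrite in_setI xB andbT => xF /setIP[pF pB].
  have [y yF [yu yx]] := down x (subsetP BA _ xB) xF pF.
  by exists y => //; rewrite in_setI yF (c2 x y).
Qed.

(** * The path from a vertex up to the root *)

Definition branch v : {set V} := [set x | fconnect par v x].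

Lemma branch_refl v : v \in branch v.
Proof. by rewrite inE connect0. Qed.

Lemma branch_par v x : x \in branch v -> par x \in branch v.
Proof. by rewrite !inE => /connect_trans; apply; exact: fconnect1. Qed.

Lemma branch_iter v x : x \in branch v -> exists k, x = iter k par v.
Proof. by rewrite inE => h; exists (findex par v x); rewrite iter_findex. Qed.

Lemma branch_ind v (P : V -> Prop) :
  P v -> (forall x, x \in branch v -> P x -> P (par x)) ->
  forall x : V, x \in branch v -> P x.
Proof.
move=> Pv PS x /branch_iter[k ->].
elim: k => //= k; apply: PS; by rewrite inE fconnect_iter.
Qed.

Lemma branch_root v : u \in branch v.
Proof.
move: {2}(d v).+1 (ltnSn (d v)) => m; elim: m v => // m IH v lem.
case: (eqVneq v u) => [->|vu]; first exact: branch_refl.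
have := IH (par v); rewrite inE => /(_ _) h.
rewrite inE; apply: connect_trans (fconnect1 _ _) (h _).
exact: leq_trans (depth_par vu) _.
Qed.

Lemma branch_of_root x : x \in branch u -> x = u.
Proof. by elim/branch_ind => // y _ ->. Qed.

Lemma branch_step v x : x \in branch v -> x != v ->
  exists2 y, y \in branch v & par y = x.
Proof.
move=> /branch_iter[[|k] ->]; first by rewrite eqxx.
by move=> _; exists (iter k par v); rewrite // inE fconnect_iter.
Qed.

Lemma branch_tail v x : x \in branch v -> x != v -> x \in branch (par v).
Proof.
move=> /branch_iter[[|k] ->]; first by rewrite eqxx.
by move=> _; rewrite iterSr inE fconnect_iter.
Qed.

Lemma branch_depth v x : x \in branch v -> x != v -> v != u -> d x < d v.
Proof.
move=> xP xv vu; move: xP (branch_tail xP xv) => _.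
elim/branch_ind => [|y _ IH]; first exact: depth_par.
case: (eqVneq y u) => [yu|yu]; first by rewrite yu par_root -yu.
exact: ltn_trans (depth_par yu) IH.
Qed.

Lemma branch_no_child v y : v != u -> y \in branch v -> y != u -> par y != v.
Proof.
move=> vu yP yu; apply/eqP => yv.
case: (eqVneq y v) => [e|nyv]; first by move: (par_neq yu); rewrite yv e eqxx.
by have := ltn_trans (depth_par yu) (branch_depth yP nyv vu); rewrite yv ltnn.
Qed.

(** The climb starts at [v], which is in [F], and [rf_up] forbids two consecutive misses. *)
Lemma branch_hit v A F x :
  rfort v A F -> x \in branch v -> x \in F \/ par x \in F.
Proof.
case=> FA uF vF pA inj up alone down; elim/branch_ind=> [|y _ IH]; first by left.
case: (boolP (par y \in F)) => [|pF]; [by left | right].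
case: IH => [yF|]; last by rewrite (negPf pF).
by apply: up => //; apply: contraNneq pF => ->; rewrite par_root.
Qed.

(** Take [x] of least depth among the vertices of [F'] not in [F]. If [par x] is in [F], then
    [rf_down] puts a child of [x] in [F], and [F'] has three consecutive vertices, against
    [rf_alone]. Otherwise [par (par x)] is in [F], and [rf_down] gives a child of [par x] in [F],
    which [rf_inj] identifies with [x]. *)
Lemma rfort_antichain v A F F' :
  rfort v A F -> rfort v A F' -> F \subset F' -> F = F'.
Proof.
move=> [FA uF vF pA inj up alone down] [FA' uF' vF' pA' inj' up' alone' down'].
move=> sFF'; apply/eqP; rewrite eqEsubset sFF' /=.
apply/subsetP => x0 x0F'; apply/negPn/negP => x0F.
have x0D : x0 \in F' :\: F by rewrite inE x0F' andbT.
case: (arg_minnP d x0D) => x /setDP[xF' xF] xmin.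
have low y : d y < d x -> y \in F' -> y \in F.
  move=> yx yF'; apply/negPn/negP => yF.
  suff /xmin : y \in F' :\: F by rewrite leqNgt yx.
  by rewrite inE yF.
have xu : x != u by apply: contraNneq xF => ->.
have sub := subsetP sFF'.
case: (boolP (par x \in F)) => pF.
  have [z zF [zu zx]] := down x (subsetP FA' _ xF') xF pF.
  by have := alone' z (sub _ zF) zu; rewrite zx xF' sub // => /(_ isT xu).
have pF' : par x \notin F' by apply: contra pF => /low; apply; exact: depth_par.
have pu : par x != u by apply: contraNneq pF => ->.
have ppF : par (par x) \in F.
  by apply: low (up' _ xF' xu pF'); apply: ltn_trans (depth_par xu); exact: depth_par.
have [y yF [yu yx]] := down _ (pA' _ xF') pF ppF.
by move: xF; rewrite (inj' x y xF' (sub _ yF) xu yu (esym yx)) yF.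
Qed.

(** [X] rebuilds the part of a set outside [B] from its trace on [B], so taking traces is
    injective. *)
Lemma leq_card_restrict (S R : {set {set V}}) B (X : {set V} -> {set V}) :
  (forall F, F \in S -> F :&: B \in R /\ F = F :&: B :|: X (F :&: B)) ->
  #|S| <= #|R|.
Proof.
move=> h; rewrite -(card_in_imset (f := fun F => F :&: B) (D := mem S)).
  by apply: subset_leq_card; apply/subsetP => _ /imsetP[F /h[FR _] ->].
by move=> F F' /h[_ e] /h[_ e'] /= ee; rewrite e ee -e'.
Qed.

(** What remains is closed under [par], and every deleted vertex of [F] is a child of the deleted
    [c], so no remaining vertex loses a child in [F]. *)
Lemma rfort_prune v w (A K F : {set V}) c :
  rfort v A F -> (forall y, y \in A -> par y \in A) -> c != u -> c \notin F ->
  (forall y, y \in K -> par y = c) ->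
  (forall y, y \in A -> par y = c -> y \in K) ->
  (forall y z, y \in K -> z \in A -> par z != y) ->
  w \in F -> w \notin K -> rfort w (A :\: (c |: K)) (F :&: (A :\: (c |: K))).
Proof.
move=> gF clA cu cF Kc cK leafK wF wK; have FA := subsetP (rf_sub gF).
have inB y : (y \in A :\: (c |: K)) = [&& y != c, y \notin K & y \in A].
  by rewrite !inE negb_or andbA.
have step y : y \in A :\: (c |: K) -> par y \in A :\: (c |: K).
  rewrite !inB => /and3P[yc yK yA]; apply/and3P; split; last exact: clA.
    by apply: contraNneq yK => /cK; apply.
  by apply/negP => /leafK /(_ yA); rewrite eqxx.
apply: (rfort_restrict gF _ _ wF); first exact: subsetDl.
- rewrite inB eq_sym cu (FA _ (rf_root gF)) andbT; apply: contraNN cu => /Kc.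
  by rewrite par_root => ->.
- by rewrite inB wK (FA _ wF) !andbT; apply: contraNneq cF => <-.
- by move=> y _; exact: step.
- by move=> y _ yB _; exact/step/step.
move=> x y; rewrite !inB => /and3P[xc _ _] _ yF yx; apply/and3P; split; last exact: FA.
  by apply: contraNneq cF => <-.
by apply: contraNN xc => /Kc; rewrite yx => ->.
Qed.

(** With [c] in [F], the leaf [l] is forced in by [rf_down], [par c] out by [rf_alone], and
    [par (par c)] in by [rf_up]. Other children of [par c] may stay behind without a parent in [B];
    by [rf_inj] none of them is in [F]. *)
Lemma rfort_prune2 v (A F : {set V}) c l :
  rfort v A F -> (forall y, y \in A -> par y \in A) -> l \in A -> c != u ->
  c \in F -> par l = c -> (forall y, y \in A -> par y = c -> y = l) ->
  (forall z, z \in A -> par z != l) ->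
  let B := A :\: [set l; c; par c] in
  [/\ l \in F, par c \notin F, par (par c) \in B, F = F :&: B :|: [set l; c] &
   forall w, w \in F -> w != l -> w != c -> rfort w B (F :&: B)].
Proof.
move=> gF clA lA cu cF lc cl leafl B; have FA := subsetP (rf_sub gF).
have lF : l \in F.
  apply/negPn/negP => lF; have [|y yF [_ yl]] := rf_down gF lA lF; first by rewrite lc.
  by have := leafl y (FA _ yF); rewrite yl eqxx.
have lu : l != u by apply: par_neq_root cu lc.
have pF : par c \notin F by rewrite -lc (rf_alone gF) ?lc.
have pu : par c != u by apply: contraNneq pF => ->; exact: rf_root gF.
have inB y : (y \in B) = [&& y != l, y != c, y != par c & y \in A].
  by rewrite !inE !negb_or !andbA.
have onlyc y : y \in F -> par y = par c -> y = c.
  move=> yF yc; apply: (rf_inj gF) => //; exact: par_neq_root pu yc.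
have step y : y \in F -> y \in B -> par y \in B.
  rewrite !inB => yF /and4P[yl yc yp yA]; rewrite leafl // clA // andbT /=.
  by apply/andP; split; [apply: contraNneq yl => /cl | apply: contraNneq yc => /onlyc] => ->.
have ppF : par (par c) \in F by exact: (rf_up gF).
split=> //.
- rewrite inB (FA _ ppF) leafl ?par_neq ?clA ?FA //= andbT.
  apply: contraNneq pF => pc; move: (depth_par cu) (depth_par pu).
  by rewrite pc => h1 /(ltn_trans h1); rewrite ltnn.
- apply/setP => y; rewrite in_setU in_setI inB !inE.
  case: (boolP (y \in F)) => yF; last first.
    by apply/esym/negbTE; rewrite negb_or /=; apply: contraNN yF => /orP[] /eqP ->.
  rewrite (FA _ yF) andbT /=.
  have -> : y != par c by apply: contraNneq pF => <-.
  by case: (y == l); case: (y == c).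
move=> w wF wl wc; apply: (rfort_restrict gF _ _ wF).
- exact: subsetDl.
- rewrite inB !(eq_sym u) lu cu pu; apply/FA; exact: rf_root gF.
- by rewrite inB wl wc FA // andbT; apply: contraNneq pF => <-.
- exact: step.
- move=> y yF yB yu; case: (boolP (par y \in F)) => zF; first exact: (step _ zF (step _ yF yB)).
  have zzF := rf_up gF yF yu zF; rewrite inB FA // andbT leafl ?clA ?FA //=.
  apply/andP; split; last by apply: contraNneq pF => <-.
  apply: contraNneq zF => /cl -> //; exact/clA/FA.
move=> x y; rewrite !inB => /and4P[xl xc xp xA] xF yF yx; rewrite FA // andbT.
apply/and3P; split; first by apply: contraNneq xc => yl; rewrite -yx yl lc.
  by apply: contraNneq xp => yc; rewrite -yx yc.
by apply: contraNneq pF => <-.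
Qed.

Lemma rfort_delete v (A F : {set V}) x :
  rfort v A F -> x \notin F -> (forall y, y \in F -> par y != x) ->
  (forall y, y \in F -> par (par y) != x) -> rfort v (A :\ x) F.
Proof.
move=> gF xF px ppx; have FA := subsetP (rf_sub gF).
have FB : F \subset A :\ x by rewrite subsetD1 (rf_sub gF).
rewrite -(setIidPl FB); apply: (rfort_restrict gF _ _ (rf_mark gF)).
- exact: subsetDl.
- exact: (subsetP FB _ (rf_root gF)).
- exact: (subsetP FB _ (rf_mark gF)).
- by move=> y yF _; rewrite !inE px // (rf_par gF).
- move=> y yF _ yu; rewrite !inE ppx //=.
  case: (boolP (par y \in F)) => [/(rf_par gF) //|pF].
  exact/FA/(rf_up gF).
- by move=> z y _ _ yF _; exact: (subsetP FB).
Qed.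

(** Such an [x] is not in [F]; a child of [x] in [F] would force in [par x], and a grandchild in [F]
    would force in [x] or a child of [x]. *)
Lemma rforts_dangling v (A : {set V}) x : par x \notin A -> rforts v A \subset rforts v (A :\ x).
Proof.
move=> pxA; apply/subsetP => F /rfortsP gF; apply/rfortsP.
have FA := subsetP (rf_sub gF).
have xF : x \notin F by apply: contra pxA => /(rf_par gF).
have xu : x != u.
  by apply: contraNneq pxA => ->; rewrite par_root; exact/FA/(rf_root gF).
have px y : y \in F -> par y != x.
  move=> yF; apply: contraNneq pxA => yx; have yu := par_neq_root xu yx.
  by rewrite -yx; apply/FA/(rf_up gF) => //; rewrite yx.
apply: rfort_delete => // y yF; case: (boolP (par y \in F)) => [/px //|pF].
have yu : y != u by apply: contraNneq pF => yu; rewrite yu par_root; exact: rf_root gF.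
by apply: contraNneq xF => <-; exact: (rf_up gF).
Qed.

(** * A vertex whose children are all leaves *)

Section Cherry.
Variables (v : V) (A K : {set V}) (c : V).
Hypothesis closedA : forall y, y \in A -> par y \in A.
Hypothesis cA : c \in A.
Hypothesis cu : c != u.
Hypothesis KP : forall y, (y \in K) = (y \in A) && (par y == c).
Hypothesis leafK : forall y z, y \in K -> z \in A -> par z != y.

Let B := A :\: (c |: K).

Lemma cherry_par y : y \in K -> par y = c.
Proof. by rewrite KP => /andP[_ /eqP]. Qed.

Lemma cherry_sub y : y \in K -> y \in A.
Proof. by rewrite KP => /andP[]. Qed.

Lemma cherry_root y : y \in K -> y != u.
Proof. by move=> /cherry_par; exact: par_neq_root. Qed.

Lemma cherry_top F : rfort v A F -> c \in F -> {subset K <= F}.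
Proof.
move=> gF cF y yK; apply/negPn/negP => yF.
have [|z zF [_ zy]] := rf_down gF (cherry_sub yK) yF; first by rewrite cherry_par.
by have := leafK yK (subsetP (rf_sub gF) _ zF); rewrite zy eqxx.
Qed.

Lemma cherry_inj F y z : rfort v A F -> y \in K -> z \in K -> y \in F -> z \in F -> y = z.
Proof.
move=> gF yK zK yF zF; apply: (rf_inj gF) => //; try exact: cherry_root.
by rewrite !cherry_par.
Qed.

Lemma cherry_notin F : rfort v A F -> 1 < #|K| -> c \notin F.
Proof.
move=> gF K1; apply/negP => cF; have KF := cherry_top gF cF.
have /card_gt1P[y [z [yK zK]]] := K1.
by rewrite (cherry_inj gF yK zK) ?KF ?eqxx.
Qed.

(** Together with [cherry_down]: when [c] is out of [F], the trace on [B] tells through [par c]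
    whether [F] meets [K]. *)
Lemma cherry_up F y : rfort v A F -> c \notin F -> y \in K -> y \in F -> par c \in F.
Proof.
move=> gF cF yK yF; rewrite -(cherry_par yK).
by apply: (rf_up gF) => //; rewrite ?cherry_root ?cherry_par.
Qed.

Lemma cherry_down F : rfort v A F -> c \notin F -> par c \in F ->
  exists2 y, y \in K & y \in F.
Proof.
move=> gF cF pF; have [y yF [_ yc]] := rf_down gF cA cF pF.
by exists y; rewrite // KP yc (subsetP (rf_sub gF)) ?eqxx.
Qed.

Lemma cherry_prune w F : rfort v A F -> c \notin F -> w \in F -> w \notin K ->
  rfort w B (F :&: B).
Proof.
move=> gF cF wF wK; apply: (rfort_prune gF) => // [y /cherry_par|y yA yc] //.
by rewrite KP yA yc eqxx.
Qed.

Lemma cherry_parB : par c \in B.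
Proof.
rewrite !inE negb_or par_neq // closedA // andbT /=.
by apply/negP => /leafK /(_ cA); rewrite eqxx.
Qed.

Lemma cherry_split F : rfort v A F -> c \notin F -> F = F :&: B :|: F :&: K.
Proof.
move=> gF cF; apply/setP => y; rewrite !inE.
case: (boolP (y \in F)) => //= yF; rewrite (subsetP (rf_sub gF) _ yF) andbT.
have /negPf -> /= : y != c by apply: contraNneq cF => <-.
by case: (y \in K).
Qed.

(** Split by whether [c] is in [F]. The marks [w1] and [w2] are free because [l] may be [v], and
    then an ancestor takes over the mark. *)
Lemma card_cherry_single l w1 w2 : K = [set l] -> w1 != l ->
  (forall F, rfort v A F -> c \notin F -> w1 \in F) ->
  (forall F, rfort v A F -> c \in F -> [/\ w2 \in F, w2 != l & w2 != c]) ->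
  #|rforts v A| <= #|rforts w1 B| + #|rforts w2 (A :\: [set l; c; par c])|.
Proof.
move=> Kl w1l h1 h2; have lK : l \in K by rewrite Kl set11.
rewrite -(cardsID [set F : {set V} | c \in F] (rforts v A)) addnC.
apply: leq_add.
  (* With [c] out of [F], [l] is in [F] exactly if [par c] is, which the trace on [B] records. *)
  pose X (G : {set V}) := if par c \in G then [set l] else set0.
  apply: (@leq_card_restrict _ _ B X) => F; rewrite inE [X in ~~ X]inE.
  move=> /andP[cF /rfortsP gF]; split.
    apply/rfortsP/cherry_prune => //; first exact: h1.
    by rewrite Kl inE.
  rewrite {1}(cherry_split gF cF); congr setU.
  rewrite /X in_setI cherry_parB andbT; apply/setP => y; rewrite in_setI.
  case: ifP => [/(cherry_down gF cF)[z]|pF]; rewrite Kl !inE.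
    by move=> /eqP -> lF; case: eqP => [->|]; rewrite ?lF ?andbF.
  apply/negP => /andP[yF /eqP yl]; move: pF.
  by rewrite (cherry_up gF cF lK) // -yl.
pose B2 := A :\: [set l; c; par c].
apply: (@leq_card_restrict _ _ B2 (fun=> [set l; c])) => F.
case/setIP=> /rfortsP gF; rewrite inE => cF.
have [w2F w2l w2c] := h2 F gF cF.
have [||_ _ _ e g] := rfort_prune2 gF closedA (cherry_sub lK) cu cF (cherry_par lK).
- by move=> y yA yc; apply/set1P; rewrite -Kl KP yA yc eqxx.
- by move=> z; exact: leafK.
by split=> //; apply/rfortsP/g.
Qed.

Hypothesis vK : v \notin K.

(** A child [y] in [F] forces in [par c] and excludes its siblings, so [F] is its trace on [B] plus
    [y]. *)
Lemma card_cherry_leaf y : y \in K ->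
  #|[set F in rforts v A | (c \notin F) && (y \in F)]| <=
  #|[set F in rforts v B | par c \in F]|.
Proof.
move=> yK; apply: (@leq_card_restrict _ _ B (fun=> [set y])) => F.
rewrite inE => /andP[/rfortsP gF /andP[cF yF]]; split.
  rewrite inE in_setI cherry_parB (cherry_up gF cF yK yF) !andbT.
  by apply/rfortsP/cherry_prune => //; exact: rf_mark gF.
rewrite {1}(cherry_split gF cF); congr setU; apply/setP => z.
rewrite !inE; apply/andP/eqP => [[zF zK]|-> //].
exact: cherry_inj gF zK yK zF yF.
Qed.

Lemma card_cherry_empty :
  #|[set F in rforts v A | (c \notin F) && [disjoint F & K]]| <=
  #|[set F in rforts v B | par c \notin F]|.
Proof.
apply: (@leq_card_restrict _ _ B (fun=> set0)) => F.
rewrite inE => /andP[/rfortsP gF /andP[cF FK]]; split.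
  rewrite inE in_setI cherry_parB andbT; apply/andP; split.
    by apply/rfortsP/cherry_prune => //; exact: rf_mark gF.
  apply/negP => /(cherry_down gF cF)[y yK yF].
  by move: FK; rewrite disjoint_subset => /subsetP /(_ y yF); rewrite inE yK.
by rewrite {1}(cherry_split gF cF) (disjoint_setI0 FK).
Qed.

(** Two or more children keep [c] out of [F]. A trace on [B] containing [par c] then extends by a
    single child, any other trace by none. *)
Lemma card_cherry : 1 < #|K| ->
  #|rforts v A| <= #|K| * #|[set F in rforts v B | par c \in F]|
                   + #|[set F in rforts v B | par c \notin F]|.
Proof.
move=> K1; set X := #|_|; set Y := #|_|.
pose S y := [set F in rforts v A | (c \notin F) && (y \in F)].
have : rforts v A \subset (\bigcup_(y in K) S y) :|:
    [set F in rforts v A | (c \notin F) && [disjoint F & K]].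
  apply/subsetP => F FA; have /rfortsP gF := FA.
  have cF := cherry_notin gF K1; rewrite in_setU [X in _ || X]inE FA cF /=.
  case: (boolP [disjoint F & K]) => [|/pred0Pn[y /andP[yF yK]]]; first by rewrite orbT.
  by apply/orP; left; apply/bigcupP; exists y; rewrite // inE FA cF.
move=> /subset_leq_card /leq_trans; apply.
apply: leq_trans (leq_card_setU _ _).1 _; apply: leq_add card_cherry_empty.
rewrite -sum_nat_const; apply: leq_trans (leq_card_bigcup K S) _.
by apply: leq_sum => y yK; exact: card_cherry_leaf.
Qed.

(** If the leaf [y] is out of [F] it can be deleted; if it is in, the trace on [B] determines [F].
    This treats all cases of four or more children alike. *)
Lemma card_cherry_pick y : 1 < #|K| -> y \in K ->
  #|rforts v A| <= #|rforts v (A :\ y)| + #|rforts v B|.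
Proof.
move=> K1 yK; rewrite -(cardsID [set F : {set V} | y \in F] (rforts v A)) addnC.
apply: leq_add.
  apply: subset_leq_card; apply/subsetP => F; rewrite inE [X in ~~ X]inE.
  move=> /andP[yF /rfortsP gF]; apply/rfortsP; have FA := subsetP (rf_sub gF).
  apply: rfort_delete => // z zF; first exact: leafK (FA _ zF).
  exact: leafK (closedA (FA _ zF)).
apply: leq_trans (leq_trans (card_cherry_leaf yK) _); apply: subset_leq_card.
  apply/subsetP => F; rewrite !in_setI 2!inE => /andP[gF yF].
  by rewrite gF yF andbT; apply: cherry_notin K1; apply/rfortsP.
by apply/subsetP => F; rewrite inE => /andP[].
Qed.

End Cherry.

(** Two such sets differ in at most one vertex, so one contains the other and [rfort_antichain]
    makes them equal. *)
Lemma card_rfort_squeeze v (A C D : {set V}) (S : {set {set V}}) :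
  S \subset rforts v A -> #|D :\: C| <= 1 ->
  (forall F, F \in S -> C \subset F /\ F \subset D) -> #|S| <= 1.
Proof.
move=> SA CD h; apply/card_le1_eqP => F F' FS F'S.
wlog sFF' : F F' FS F'S / F \subset F'.
  move=> W; case: (boolP (F \subset F')) => [|/subsetPn[x xF xF']]; first exact: W.
  apply/esym/W => //; apply/subsetP => y yF'.
  have [[CF FD] [CF' FD']] := (h F FS, h F' F'S).
  case: (boolP (y \in C)) => [/(subsetP CF) //|yC].
  have xC : x \notin C by apply: contra xF' => /(subsetP CF').
  have /card_le1_eqP /(_ x y) -> // : #|D :\: C| <= 1 by [].
    by rewrite inE xC (subsetP FD).
  by rewrite inE yC (subsetP FD').
have /rfortsP gF := subsetP SA _ FS; have /rfortsP gF' := subsetP SA _ F'S.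
by rewrite (rfort_antichain gF gF' sFF').
Qed.

(* That nothing hangs off the path at [u] or [v] is needed: for the path
[u - a - b - v] with a star [K_(1,3)] attached to [u] by its centre there are
6 such sets, whereas [pad 8 = 5]. *)
Lemma card_rforts v (A : {set V}) :
  (forall y, y \in A -> y \notin branch v -> [/\ v != u, par y != u & par y != v]) ->
  #|rforts v A| <= pad #|A|.
Proof.
have [m] := ubnP #|A|; elim: m v A => // m IH v A Am H.
have {}IH w (B : {set V}) : B \proper A ->
    (forall y, y \in B -> y \notin branch w -> [/\ w != u, par y != u & par y != w]) ->
    #|rforts w B| <= pad #|B|.
  by move=> /proper_card BA; apply: IH; exact: leq_trans BA _.
have {}IHv (B : {set V}) x : B \subset A :\ x -> x \in A -> #|rforts v B| <= pad #|B|.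
  move=> BA xA; apply: IH; first exact: sub_proper_trans BA (properD1 xA).
  by move=> y yB; apply: H; apply: (subsetP (subset_trans BA (subsetDl _ _))).
have [->|[F0 /rfortsP gF0]] := set_0Vmem (rforts v A); first by rewrite cards0.
have uA : u \in A := subsetP (rf_sub gF0) _ (rf_root gF0).
have vA : v \in A := subsetP (rf_sub gF0) _ (rf_mark gF0).
(* Vertices with a missing parent are deleted first, so that [A] becomes closed under [par]. *)
have [/exists_inP[x xA pxA]|] := boolP [exists x in A, par x \notin A].
  apply: leq_trans (subset_leq_card (rforts_dangling v pxA)) _.
  apply: leq_trans (IHv _ x (subxx _) xA) _.
  exact/leq_pad/subset_leq_card/subsetDl.
rewrite negb_exists_in => /forall_inP clA0.
have clA y : y \in A -> par y \in A by move=> /clA0; rewrite negbK.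
(* If [A] lies on the path, the path is shortened at its end [v]. *)
have [Abr|] := boolP (A \subset branch v).
  have singleton (D : {set V}) : (forall F, rfort v A F -> F = D) -> #|rforts v A| <= 1.
    move=> h; rewrite -(cards1 D); apply: subset_leq_card; apply/subsetP => F /rfortsP /h ->.
    exact: set11.
  have A0 : 0 < pad #|A| by apply: pad_gt0; apply/card_gt0P; exists u.
  have [vu|vu] := eqVneq v u.
    apply: leq_trans (singleton [set u] _) A0 => F gF; apply/eqP.
    rewrite eqEsubset sub1set (rf_root gF) andbT; apply/subsetP => y /(subsetP (rf_sub gF)).
    by move=> /(subsetP Abr); rewrite vu => /branch_of_root ->; exact: set11.
  have [cu|cu] := eqVneq (par v) u.
    apply: leq_trans (singleton [set u; v] _) A0 => F gF; apply/eqP.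
    rewrite eqEsubset subUset !sub1set (rf_root gF) (rf_mark gF) !andbT.
    apply/subsetP => y /(subsetP (rf_sub gF)) /(subsetP Abr) yv; rewrite !inE.
    case: (eqVneq y v) => [|nyv]; rewrite ?orbT //.
    by have := branch_tail yv nyv; rewrite cu => /branch_of_root ->; rewrite eqxx.
  set c := par v in cu *; set p := par c.
  have vc : c != v by exact: par_neq.
  have pv : p != v by apply: branch_no_child => //; exact/branch_par/branch_refl.
  have pc : p != c by exact: par_neq.
  have cA : c \in A := clA _ vA.
  have pA : p \in A := clA _ cA.
  have leafv z : z \in A -> par z != v.
    move=> /(subsetP Abr) zv; have [->|zu] := eqVneq z u; first by rewrite par_root eq_sym.
    exact: branch_no_child.
  have onlyv z : z \in A -> par z = c -> z = v.
    move=> /(subsetP Abr) zv zc; apply/eqP/negPn/negP => nzv.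
    have zu := par_neq_root cu zc.
    by have := branch_no_child cu (branch_tail zv nzv) zu; rewrite zc eqxx.
  have KP y : (y \in [set v]) = (y \in A) && (par y == c).
    rewrite inE; apply/eqP/andP => [->|[yA /eqP yc]]; [by rewrite vA eqxx|exact: onlyv].
  have vP y z : y \in [set v] -> z \in A -> par z != y by move=> /set1P ->; exact: leafv.
  have wB : A :\: (c |: [set v]) \subset branch p.
    apply/subsetP => y; rewrite !inE negb_or -andbA => /and3P[yc yv /(subsetP Abr) yb].
    by have := branch_tail (branch_tail yb yv) yc; rewrite inE.
  have wB2 : A :\: [set v; c; p] \subset branch (par p).
    apply/subsetP => y; rewrite !inE !negb_or -!andbA => /and4P[yv yc yp yA].
    have yb := subsetP Abr _ yA.
    by have := branch_tail (branch_tail (branch_tail yb yv) yc) yp; rewrite inE.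
  (* The deleted leaf is [v] itself: the mark moves to [p] if [c] is out of [F], and to [par p] if
     [c] is in. *)
  have h1 F : rfort v A F -> c \notin F -> p \in F.
    by move=> gF cF; apply: (rf_up gF) => //; exact: rf_mark gF.
  have h2 F : rfort v A F -> c \in F -> [/\ par p \in F, par p != v & par p != c].
    move=> gF cF; have [//||_ pF ppB _ _] := rfort_prune2 gF clA vA cu cF erefl.
      exact: leafv.
    have ppF : par p \in F by apply: (rf_up gF).
    by move: ppB; rewrite !inE !negb_or -!andbA => /and4P[].
  apply: leq_trans (card_cherry_single clA cA cu KP vP erefl pv h1 h2) _.
  have c2 := cards_setD2 cA vA vc.
  have c3 : #|A :\: [set v; c; p]|.+3 = #|A| by rewrite cards_setD3 // eq_sym.
  rewrite -c3 padS3; apply: leq_add; last first.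
    apply: IH; first by apply: (proper_setD vA); rewrite !inE eqxx.
    by move=> y /(subsetP wB2) ->.
  have -> : #|A :\: [set v; c; p]|.+1 = #|A :\: (c |: [set v])| by lia.
  apply: IH; first by apply: (proper_setD vA); rewrite !inE eqxx orbT.
  by move=> y /(subsetP wB) ->.
move=> /subsetPn[x0 x0A x0v].
have x0D : x0 \in A :\: branch v by apply/setDP.
case: (arg_maxnP d x0D) => l lD lmax.
(* A child of a vertex off the path is off the path too, and deeper; so a vertex at least as deep as
   [l] has none. *)
have leafD y z : y \in A :\: branch v -> d l <= d y -> z \in A -> par z != y.
  case/setDP=> yA yv ly zA; apply: contraTneq isT => zy.
  have yu : y != u by apply: contraNneq yv => ->; exact: branch_root.
  have zu := par_neq_root yu zy.
  have zD : z \in A :\: branch v.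
    by apply/setDP; split=> //; apply: contra yv => /branch_par; rewrite zy.
  by have := leq_trans (lmax _ zD) ly; rewrite leqNgt -zy depth_par.
have [lA lv] := setDP lD; have [vu cu cv] := H l lA lv.
have leafl z : z \in A -> par z != l by exact: leafD.
have lu : l != u by apply: contraNneq lv => ->; exact: branch_root.
have nvl : v != l by apply: contraNneq lv => <-; exact: branch_refl.
set c := par l in cu cv *; have cA : c \in A := clA _ lA.
have [cb|cb] := boolP (c \in branch v).
  have [y yb yc] := branch_step cb cv; have yu := par_neq_root cu yc.
  (* [l] and [y] are siblings. If [c] is out of [F], then [branch_hit] puts [y] in and [rf_inj]
     keeps [l] out; if [c] is in, the leaf [l] is forced in. *)
  have lc F : rfort v A F -> (l \in F) = (c \in F).
    move=> gF; apply/idP/idP => [lF|cF]; apply/negPn/negP => nF.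
      have yF : y \in F by have := branch_hit gF yb; rewrite yc (negPf nF) => -[].
      by move: lv; rewrite (rf_inj gF lF yF lu yu) ?yb.
    have [z zF [_ zl]] := rf_down gF lA nF cF.
    by have := leafl z (subsetP (rf_sub gF) _ zF); rewrite zl eqxx.
  apply: leq_trans (leq_trans _ (IHv (A :\ l) l (subxx _) lA)) _; last first.
    exact/leq_pad/subset_leq_card/subsetDl.
  pose X (G : {set V}) := if c \in G then [set l] else set0.
  apply: (@leq_card_restrict _ _ (A :\ l) X) => F /rfortsP gF.
  have FA := subsetP (rf_sub gF); have cl : c != l by exact: par_neq.
  split; last first.
    apply/setP => z; rewrite /X !inE cl cA /= andbT -(lc F gF).
    case: (eqVneq z l) => [->|zl] /=; first by rewrite andbF; case: (l \in F); rewrite inE ?eqxx.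
    have -> : (z \in if l \in F then [set l] else set0) = false.
      by case: ifP; rewrite !inE ?(negPf zl).
    by rewrite orbF; case: (boolP (z \in F)) => // /FA ->.
  have inB z : z \in A -> z != l -> z \in A :\ l by move=> zA zl; rewrite !inE zl.
  apply/rfortsP/(rfort_restrict gF _ _ (rf_mark gF)).
  - exact: subsetDl.
  - by rewrite inB // eq_sym.
  - by rewrite inB.
  - by move=> z zF _; rewrite inB ?clA ?leafl ?FA.
  - by move=> z zF _ _; rewrite inB ?clA ?leafl ?clA ?FA.
  move=> x z _ xF zF zx; rewrite inB ?FA //; apply: contraNneq xF => zl.
  by rewrite -zx zl -/c -(lc F gF) -zl.
have [_ pu pv] := H c cA cb; set p := par c in pu pv.
pose K := [set y in A | par y == c].
have KP y : (y \in K) = (y \in A) && (par y == c) by rewrite inE.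
have lK : l \in K by rewrite KP lA eqxx.
(* Siblings of [l] have the same depth, so all children of [c] are leaves. *)
have leafK y z : y \in K -> z \in A -> par z != y.
  rewrite KP => /andP[yA /eqP yc]; apply: leafD.
    by apply/setDP; split=> //; apply: contra cb => /branch_par; rewrite yc.
  by rewrite (depthS lu) (depthS (par_neq_root cu yc)) yc.
have vb : v \in branch v := branch_refl v.
have vK : v \notin K.
  by rewrite KP vA; apply: contra cb => /eqP <-; exact: branch_par.
have cK : c \notin K by rewrite KP cA par_neq.
have nvc : v != c by apply: contraNneq cb => <-.
pose B := A :\: (c |: K).
have cardB : #|B| + #|K|.+1 = #|A|.
  have sA : c |: K \subset A.
    by rewrite subUset sub1set cA; apply/subsetP => y; rewrite KP => /andP[].
  have le := subset_leq_card sA; rewrite cardsU1 cK add1n in le.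
  by rewrite (cardsDS sA) cardsU1 cK add1n subnK.
have sBl : B \subset A :\ l by apply: setDS; rewrite sub1set !inE lA eqxx orbT.
have IHB : #|rforts v B| <= pad #|B| := IHv B l sBl lA.
have XY := card_set_split (rforts v B) (fun F : {set V} => p \in F).
have [K1|K1] := leqP #|K| 1.
  have /eqP/cards1P[z Kz] : #|K| = 1.
    by apply/eqP; rewrite eqn_leq K1; apply/card_gt0P; exists l.
  have {z Kz}Kl : K = [set l] by move: lK; rewrite Kz => /set1P ->.
  have pF F : rfort v A F -> c \in F -> [/\ v \in F, v != l & v != c].
    by move=> gF _; split=> //; exact: rf_mark gF.
  have mF F : rfort v A F -> c \notin F -> v \in F by move=> gF _; exact: rf_mark gF.
  apply: leq_trans (card_cherry_single clA cA cu KP leafK Kl nvl mF pF) _.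
  have c3 : #|A :\: [set l; c; p]|.+3 = #|A|.
    by apply: cards_setD3; rewrite ?clA // eq_sym ?leafl ?par_neq.
  rewrite -c3 padS3; apply: leq_add.
    apply: leq_trans IHB _; apply: leq_pad; rewrite Kl cards1 in cardB.
    clear - cardB c3; lia.
  by apply: (IHv _ l) => //; apply: setDS; rewrite sub1set !inE eqxx.
have [K4|K4] := leqP 4 #|K|.
  apply: leq_trans (card_cherry_pick clA cA cu KP leafK vK K1 lK) _.
  have Al := cardsD1 l A; rewrite lA add1n in Al.
  (* [B] lacks [c] and at least four children, which matches [padS5]. *)
  have le4 : #|B| <= #|A| - 5 by clear - cardB K4; lia.
  have e5 : #|A| = (#|A| - 5).+4.+1 by clear - cardB K4; lia.
  rewrite [X in _ <= pad X]e5 padS5; apply: leq_add.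
    by apply: leq_trans (IHv _ l (subxx _) lA) _; apply: leq_pad; clear - Al; lia.
  exact: leq_trans IHB (leq_pad le4).
(* [XY] and [IHB] bound the weighted sum by [#|K| * pad #|B|]. *)
apply: leq_trans (card_cherry clA cA cu KP leafK vK K1) _; rewrite -/B -/p.
have {K1 K4}[K2|K3] : #|K| = 2 \/ #|K| = 3 by clear - K1 K4; lia.
  have e3 : #|A| = #|B|.+3 by clear - cardB K2; lia.
  rewrite K2 e3; apply: leq_trans (pad_double _); clear - XY IHB; lia.
have e4 : #|A| = #|B|.+4 by clear - cardB K3; lia.
have inB y : y \in A -> y != c -> y \notin K -> y \in B.
  by move=> yA yc yK; apply/setDP; rewrite in_setU1 negb_or yc.
have uB : u \in B by apply: inB; rewrite 1?eq_sym // KP par_root eq_sym (negPf cu) andbF.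
have vB : v \in B by exact: inB.
have pB : p \in B := cherry_parB clA cA cu leafK.
have sub3 : [set u; v; p] \subset B by rewrite !subUset !sub1set uB vB pB.
have card3 : #|[set u; v; p]| = 3.
  by rewrite setUC cardsU1 cards2 !inE negb_or pu pv eq_sym vu.
have B3 : 2 < #|B| by rewrite -card3; exact: subset_leq_card.
(* For [#|B| = 4], three times [pad 4 = 2] exceeds [pad 8 = 5]. But [u], [v] and [p] leave one free
   vertex in [B], so at most one set contains [p] and at most one does not: 3 + 1 <= 5. *)
have [B4|B4] := eqVneq #|B| 4; last first.
  rewrite K3 e4; apply: leq_trans (pad_triple _ B4); [clear - XY IHB; lia | exact: ltnW].
have D1 : #|B :\: [set u; v; p]| <= 1 by rewrite cardsDS // B4 card3.
rewrite K3 e4 B4; apply: (@leq_trans (3 * 1 + 1)) => //; apply: leq_add.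
  rewrite leq_mul2l /=; apply: (card_rfort_squeeze (v := v) (A := B) _ D1) => [|F].
    by apply/subsetP => F; rewrite inE => /andP[].
  rewrite inE => /andP[/rfortsP gF pF]; split; last exact: rf_sub gF.
  by rewrite !subUset !sub1set (rf_root gF) (rf_mark gF) pF.
have D2 : #|(B :\ p) :\: [set u; v]| <= 1.
  by apply: leq_trans D1; rewrite setDDl setUC.
apply: (card_rfort_squeeze (v := v) (A := B) _ D2) => [|F].
  by apply/subsetP => F; rewrite inE => /andP[].
rewrite inE => /andP[/rfortsP gF pF]; split; last by rewrite subsetD1 (rf_sub gF).
by rewrite !subUset !sub1set (rf_root gF) (rf_mark gF).
Qed.

End RootedForts.

(** * Minimal forts of forests *)

Section Forest.
Variables (n : nat) (g : graph n).
Hypothesis forest_g : is_forest g.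
Implicit Types (x y z u v : 'I_n) (F : {set 'I_n}).

Lemma forest_sym x y : adj g x y = adj g y x.
Proof. by case/andP: forest_g => /andP[/forallP/(_ x)/forallP/(_ y)/eqP]. Qed.

Lemma forest_neq x y : adj g x y -> x != y.
Proof.
case/andP: forest_g => /andP[_ /forallP irr] _.
by apply: contraTneq => ->; exact: irr.
Qed.

(** Adjacency after removing [x], whose connected classes are the branches at [x]. *)
Definition avoid x : rel 'I_n := [rel y z | [&& adj g y z, y != x & z != x]].

Lemma avoid_sym x : connect_sym (avoid x).
Proof. by apply: sym_connect_sym => y z; rewrite /avoid /= forest_sym [(y != x) && _]andbC. Qed.

Lemma avoid_neq x y z : connect (avoid x) y z -> y != x -> z != x.
Proof.
case/connectP=> p + -> yx; elim: p y yx => //= w p IH y yx.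
by case/andP=> /and3P[_ _ wx]; exact: IH.
Qed.

(** A path between two distinct neighbours of [x] that avoids [x] would close a cycle through
    [x]. *)
Lemma forest_cut x y z :
  adj g x y -> adj g x z -> connect (avoid x) y z -> y = z.
Proof.
move=> xy xz /connectP[p yp zE]; apply/eqP/negPn/negP => yz.
case/andP: forest_g => _ /asboolP; apply.
case/shortenP: yp zE => q yq uq _ zE.
have yx : y != x by rewrite eq_sym forest_neq.
exists x, (y :: q); split.
- by rewrite /= xy; apply: sub_path yq => a b /and3P[].
- rewrite cons_uniq uq andbT inE negb_or eq_sym yx /=.
  elim: q y yx yq {uq xy zE yz} => //= w q IH y yx /andP[/and3P[_ _ wx] wq].
  by rewrite inE negb_or eq_sym wx (IH w).
- by case: q zE {yq uq} => //= zy; rewrite zy eqxx in yz.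
- by rewrite /= -zE forest_sym.
Qed.

(** The counting of rooted forts wants the depth equation at every vertex, whereas [par] follows
    edges only inside the component of [u]. *)
Definition rooting u (par : 'I_n -> 'I_n) (d : 'I_n -> nat) :=
  [/\ par u = u, d u = 0, forall x, x != u -> d x = (d (par x)).+1 &
   forall x, connect (adj g) u x -> x != u -> adj g x (par x)].

Lemma exists_rooting u : exists par d, rooting u par d.
Proof.
pose walk x k := `[< exists p, [/\ size p = k, path (adj g) u p & last u p = x] >].
(* The second disjunct lets the minimum exist outside the component of [u] as well. *)
have walkP x : exists k, walk x k || ~~ connect (adj g) u x.
  case: (boolP (connect (adj g) u x)) => [/connectP[p up ->]|_]; last by exists 0; rewrite orbT.
  by exists (size p); apply/orP; left; apply/asboolP; exists p.
pose dist x := ex_minn (walkP x).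
have step x : connect (adj g) u x -> x != u ->
    exists2 y, connect (adj g) u y & adj g x y /\ dist x = (dist y).+1.
  move=> ux xu; rewrite {1}/dist; case: ex_minnP => k; rewrite ux orbF => /asboolP[p [pk up px]] kmin.
  case/lastP: p pk up px => [_ _ e|q y]; first by rewrite -e eqxx in xu.
  rewrite size_rcons rcons_path last_rcons => qk /andP[uq qy] yx.
  have uy : connect (adj g) u (last u q) by apply/connectP; exists q.
  exists (last u q) => //; split; first by rewrite forest_sym -yx.
  rewrite /dist; case: ex_minnP => m; rewrite uy orbF => /asboolP[r [rm ur ry]] mmin.
  apply/eqP; rewrite eqn_leq; apply/andP; split.
    apply: kmin; apply/orP; left; apply/asboolP; exists (rcons r x).
    by rewrite size_rcons rm rcons_path ur ry last_rcons -yx.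
  rewrite -qk ltnS; apply: mmin; apply/orP; left; apply/asboolP; by exists q.
(* Breadth-first parent, one step closer to [u]; by [step] the default of [odflt] never occurs. *)
pose par x := if connect (adj g) u x && (x != u) then
  odflt u [pick y | [&& connect (adj g) u y, adj g x y & dist x == (dist y).+1]] else u.
have parP x : connect (adj g) u x -> x != u ->
    [/\ connect (adj g) u (par x), adj g x (par x) & dist x = (dist (par x)).+1].
  move=> ux xu; rewrite /par ux xu; case: pickP => [y /and3P[? ? /eqP] //|].
  by have [y uy [xy xd]] := step x ux xu => /(_ y); rewrite uy xy xd eqxx.
have distu : dist u = 0.
  rewrite /dist; case: ex_minnP => k _ /(_ 0); rewrite leqn0 => kmin; apply/eqP/kmin.
  by apply/orP; left; apply/asboolP; exists [::].
(* Outside the component every vertex has parent [u] and depth 1, which keeps the depth equation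
   true. *)
exists par, (fun x => if connect (adj g) u x then dist x else 1).
split; rewrite ?connect0 //.
- by rewrite /par eqxx andbF.
- move=> x xu; case: ifP => [ux|ux]; first by have [-> _ ->] := parP x ux xu.
  by rewrite /par ux connect0 distu.
- by move=> x ux xu; have [] := parP x ux xu.
Qed.

(** * Confining a minimal fort to branches and components *)

Lemma minfort_fort F : is_minimal_fort g F -> is_fort g F.
Proof. by case/andP. Qed.

Lemma minfort_min F F' : is_minimal_fort g F -> F' \subset F -> is_fort g F' -> F' = F.
Proof.
case/andP=> _ /forallP/(_ F') h sF fF'; apply/eqP; rewrite eqEproper sF /=.
by apply: contraTN fF' => /(implyP h).
Qed.

Lemma fortP F x y : is_fort g F -> x \notin F -> y \in F -> adj g x y ->
  exists z, [/\ z \in F, adj g x z & z != y].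
Proof.
case/andP=> _ /forallP/(_ x)/implyP h /h; rewrite neq_ltn => + yF xy.
have yS : y \in [set u in F | adj g x u] by rewrite inE yF.
case/orP=> [|/card_gt1P[a [b []]]].
  by rewrite ltnS leqn0 cards_eq0 => /eqP e; rewrite e inE in yS.
rewrite !inE => /andP[aF xa] /andP[bF xb] ab.
by case: (eqVneq a y) => [ay|ay]; [exists b; rewrite -ay eq_sym | exists a].
Qed.

(* The part of [F] lying in the two branches is a fort by itself. *)
Lemma minfort_two F x y1 y2 z : is_minimal_fort g F ->
  y1 \in F -> y2 \in F -> y1 != y2 -> adj g x y1 -> adj g x y2 -> z \in F ->
  connect (avoid x) y1 z || connect (avoid x) y2 z.
Proof.
move=> mF y1F y2F y12 xy1 xy2 zF.
pose B := [set z | connect (avoid x) y1 z || connect (avoid x) y2 z].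
suff e : F :&: B = F by move: zF; rewrite -e !inE => /andP[].
apply: (minfort_min mF (subsetIl _ _)).
have y1x : y1 != x by rewrite eq_sym forest_neq.
have y2x : y2 != x by rewrite eq_sym forest_neq.
have xB : x \notin B.
  by rewrite inE; apply/norP; split; apply/negP => /avoid_neq; rewrite eqxx => /(_ _)/negP; apply.
have stepB a b : a \in B -> b != x -> adj g a b -> b \in B.
  move=> aB bx ab; have ax : a != x by apply: contraNneq xB => <-.
  have /connect1 c : avoid x a b by rewrite /avoid /= ab ax.
  by move: aB; rewrite !inE => /orP[] h; rewrite (connect_trans h c) ?orbT.
have y1B : y1 \in B by rewrite inE connect0.
have y2B : y2 \in B by rewrite inE connect0 orbT.
have fF := minfort_fort mF.
apply/andP; split; first by apply/set0Pn; exists y1; rewrite inE y1F.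
apply/forallP => w; apply/implyP => wF'.
have [->|wx] := eqVneq w x.
  rewrite neq_ltn; apply/orP; right; apply/card_gt1P; exists y1, y2.
  by rewrite [_ \in _]inE in_setI y1F y1B xy1 [_ \in _]inE in_setI y2F y2B xy2.
have [wB|wB] := boolP (w \in B); last first.
  suff -> : [set u in F :&: B | adj g w u] = set0 by rewrite cards0.
  apply/setP => a; rewrite in_set0; apply/negP; rewrite inE => /andP[/setIP[_ aB] wa].
  by move: wB; rewrite (stepB a w) // forest_sym.
have wF : w \notin F by apply: contra wF' => wF; rewrite inE wF.
have -> : [set u in F :&: B | adj g w u] = [set u in F | adj g w u].
  apply/setP => a; rewrite [LHS]inE [RHS]inE in_setI.
  case: (boolP (a \in F)) => //= aF; case: (boolP (adj g w a)); rewrite ?andbF // => wa.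
  (* Only [x] could be a neighbour of [w] outside [B]; but then [w] is [y1] or [y2] by [forest_cut],
     and these lie in [F]. *)
  rewrite andbT; apply: (stepB w a wB _ wa); apply: contraNneq wF => ax.
  move: wB; rewrite inE => /orP[] /forest_cut <- //; by rewrite forest_sym -ax.
by have /andP[_ /forallP/(_ w)/implyP->] := fF.
Qed.

(** The trace of a fort on a component that it meets is again a fort. *)
Lemma minfort_connected F u : is_minimal_fort g F -> u \in F ->
  F \subset [set x | connect (adj g) u x].
Proof.
move=> mF uF; set C := [set x | _]; have fF := minfort_fort mF.
suff <- : F :&: C = F by exact: subsetIr.
have stepC a b : adj g a b -> a \in C -> b \in C.
  by move=> ab; rewrite !inE => /connect_trans; apply; exact: connect1.
apply: (minfort_min mF (subsetIl _ _)).
apply/andP; split; first by apply/set0Pn; exists u; rewrite !inE uF connect0.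
apply/forallP => w; apply/implyP => wF'.
have [wC|wC] := boolP (w \in C); last first.
  suff -> : [set a in F :&: C | adj g w a] = set0 by rewrite cards0.
  apply/setP => a; rewrite in_set0; apply/negP; rewrite inE => /andP[/setIP[_ aC] wa].
  by move: wC; rewrite (stepC a w) // forest_sym.
have wF : w \notin F by apply: contra wF' => wF; rewrite in_setI wF.
have -> : [set a in F :&: C | adj g w a] = [set a in F | adj g w a].
  apply/setP => a; rewrite [LHS]inE [RHS]inE in_setI.
  case: (boolP (adj g w a)); rewrite ?andbF // => wa.
  by rewrite (stepC w a) // andbT.
by have /andP[_ /forallP/(_ w)/implyP->] := fF.
Qed.

(** * Minimal forts as rooted forts *)

Section Rooted.
Variables (u : 'I_n) (par : 'I_n -> 'I_n) (d : 'I_n -> nat).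
Hypothesis rooted : rooting u par d.

Let par_u : par u = u. Proof. by case: rooted. Qed.
Let d_u : d u = 0. Proof. by case: rooted. Qed.
Let dS x : x != u -> d x = (d (par x)).+1.
Proof. by case: rooted => _ _ h _; exact: h. Qed.
Let adj_p x : connect (adj g) u x -> x != u -> adj g x (par x).
Proof. by case: rooted => _ _ _; apply. Qed.

Definition component := [set x | connect (adj g) u x].

Lemma component_adj x y : adj g x y -> x \in component -> y \in component.
Proof. by rewrite !inE => xy /connect_trans; apply; exact: connect1. Qed.

Lemma component_par x : x \in component -> par x \in component.
Proof.
have [-> _|xu xC] := eqVneq x u; first by rewrite par_u inE connect0.
by apply: component_adj (xC); apply: adj_p; rewrite // inE in xC.
Qed.

(** Depth falls strictly along the climb from [x] to [u], so the climb never meets [z]. *)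
Lemma connect_root x z : x \in component -> x != z -> d x <= d z ->
  connect (avoid z) x u.
Proof.
have [m] := ubnP (d x); elim: m x => // m IH x xm xC xz xdz.
have [->|xu] := eqVneq x u; first exact: connect0.
have pd : d (par x) < d x by rewrite (dS xu).
have pz : par x != z.
  by apply: contraTneq pd => pz; rewrite pz -leqNgt.
have xp : avoid z x (par x) by rewrite /avoid /= adj_p ?xz //; rewrite inE in xC.
apply: connect_trans (connect1 xp) (IH _ _ (component_par xC) pz _).
  by apply: leq_trans pd _; rewrite -ltnS.
exact: ltnW (leq_trans pd xdz).
Qed.

(** If [y] is the end at least as deep, both [x] and [par y] reach the root avoiding [y], so
    [forest_cut] identifies them. *)
Lemma adj_parent x y : x \in component -> adj g x y ->
  x != u /\ par x = y \/ y != u /\ par y = x.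
Proof.
move=> xC xy; have yC := component_adj xy xC; have nxy := forest_neq xy.
wlog dxy : x y xy xC yC nxy / d x <= d y.
  move=> W; have [|/ltnW] := leqP (d x) (d y); first exact: W.
  by rewrite or_comm; apply: W; rewrite // 1?forest_sym // eq_sym.
right; have yu : y != u.
  apply: contraNneq nxy => yu; move: dxy; rewrite yu d_u leqn0.
  by have [//|/dS ->] := eqVneq x u.
have pC := component_par yC; have pd : d (par y) < d y by rewrite (dS yu).
split=> //; apply/eqP/negPn/negP => px.
have py : par y != y by apply: contraTneq pd => ->; rewrite ltnn.
have c := connect_trans (connect_root pC py (ltnW pd)) _.
move: px; rewrite (@forest_cut y (par y) x) ?eqxx // 1?forest_sym //.
- by rewrite forest_sym; apply: adj_p; rewrite // inE in yC.
- by apply: c; rewrite avoid_sym; exact: connect_root.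
Qed.

Lemma minfort_rfort F v : is_minimal_fort g F -> u \in F -> v \in F ->
  rfort u par v component F.
Proof.
move=> mF uF vF; have fF := minfort_fort mF; have FC := minfort_connected mF uF.
have adjp y : y \in F -> y != u -> adj g y (par y).
  by move=> /(subsetP FC); rewrite inE => uy yu; exact: adj_p.
have inj y z : y \in F -> z \in F -> y != u -> z != u -> par y = par z -> y = z.
  move=> yF zF yu zu yz; apply/eqP/negPn/negP => nyz.
  set x := par y in yz.
  have xy : adj g x y by rewrite forest_sym adjp.
  have xz : adj g x z by rewrite yz forest_sym adjp.
  have yx := forest_neq xy; have zx := forest_neq xz; rewrite eq_sym in yx; rewrite eq_sym in zx.
  (* Two siblings in [F] confine [F], hence [u], to their branches at [x]; but [u] is [x] itself or
     lies in the branch of [par x]. *)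
  have cu := minfort_two mF yF zF nyz xy xz uF.
  have [xu|xu] := eqVneq x u.
    by case/orP: cu => /avoid_neq; rewrite ?yx ?zx xu eqxx => /(_ isT).
  have xC : x \in component by apply/component_par/(subsetP FC).
  have pd : d (par x) < d x by rewrite (dS xu).
  have px : par x != x by apply: contraTneq pd => ->; rewrite ltnn.
  have cp := connect_root (component_par xC) px (ltnW pd).
  have xp : adj g x (par x) by apply: adj_p; rewrite // inE in xC.
  rewrite avoid_sym in cp.
  case/orP: cu => /connect_trans/(_ cp).
    by move=> /(forest_cut xy xp) e; move: pd; rewrite -e (dS yu) -/x ltnNge leqnSn.
  by move=> /(forest_cut xz xp) e; move: pd; rewrite -e (dS zu) -yz ltnNge leqnSn.
split=> //.
- by move=> y /(subsetP FC); exact: component_par.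
- move=> y yF yu pF; have xy : adj g (par y) y by rewrite forest_sym adjp.
  have pu : par y != u by apply: contraNneq pF => ->.
  (* The second neighbour in [F] is the parent or another child, and [inj] excludes the child. *)
  have [z [zF xz zy]] := fortP fF pF yF xy.
  have pC := component_par (subsetP FC _ yF).
  have [[_ ->] //|[zu zx]] := adj_parent pC xz.
  by move: zy; rewrite (inj z y) ?eqxx.
- move=> y yF yu xF xu; apply/negP => pF.
  have xy : adj g (par y) y by rewrite forest_sym adjp.
  have nyp : y != par (par y).
    have lt1 : d (par y) < d y by rewrite (dS yu).
    have lt2 : d (par (par y)) < d (par y) by rewrite (dS xu).
    by apply: contraTneq (ltn_trans lt2 lt1) => <-; rewrite ltnn.
  (* The neighbours [y] and [par (par y)] of [par y] would confine [F] to branches that miss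
     [par y]. *)
  have := minfort_two mF yF pF nyp xy (adjp _ xF xu) xF.
  have px : par (par y) != par y by rewrite eq_sym; apply: forest_neq; exact: adjp.
  by case/orP=> /avoid_neq; rewrite ?px 1?eq_sym ?(forest_neq xy) eqxx => /(_ isT).
move=> x xC xF pF; have xu : x != u by apply: contraNneq xF => ->.
have xp : adj g x (par x) by apply: adj_p; rewrite // inE in xC.
have [z [zF xz zp]] := fortP fF xF pF xp.
have [[_ e]|] := adj_parent xC xz; first by rewrite e eqxx in zp.
by exists z.
Qed.

(** A deepest vertex of [F] has no child: a child in [F] would be deeper, and a child out of [F]
    would need a child of its own in [F]. *)
Lemma minfort_leaf_below F : is_minimal_fort g F -> u \in F -> F != [set u] ->
  exists x, [/\ x \in F, x != u & forall y z, adj g x y -> adj g x z -> y = z].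
Proof.
move=> mF uF Fu; have gF := minfort_rfort mF uF uF; have FC := subsetP (rf_sub gF).
have [w wF wu] : exists2 w, w \in F & w != u.
  apply/exists_inP; apply: contraNT Fu; rewrite negb_exists_in => /forall_inP h.
  rewrite eqEsubset sub1set uF andbT; apply/subsetP => w /h; by rewrite negbK inE.
case: (arg_maxnP d uF) => x xF xmax; exists x.
have xu : x != u.
  by apply: contraTneq (xmax _ wF) => ->; rewrite -ltnNge d_u dS.
suff h y : adj g x y -> y = par x by split=> // y z /h -> /h ->.
move=> xy; have [[_ -> //]|[yu yx]] := adj_parent (FC _ xF) xy.
have [yF|yF] := boolP (y \in F).
  by have : d y <= d x := xmax _ yF; rewrite (dS yu) yx ltnn.
have [|z zF [zu zy]] := rf_down gF (component_adj xy (FC _ xF)) yF; first by rewrite yx.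
by have : d z <= d x := xmax _ zF; rewrite (dS zu) zy (dS yu) yx ltnNge leqnSn.
Qed.

(** Root at [u]. As [u] and [v] are leaves, nothing hangs off the path at its two ends, as
    [card_rforts] requires. *)
Lemma card_minfort_leaves v : v != u ->
  (forall y z, adj g u y -> adj g u z -> y = z) ->
  (forall y z, adj g v y -> adj g v z -> y = z) ->
  #|[set F | [&& is_minimal_fort g F, u \in F & v \in F]]| <= pad n.
Proof.
move=> vu leafu leafv.
have [vC|vC] := boolP (v \in component); last first.
  rewrite (_ : [set F | _] = set0) ?cards0 //; apply/setP => F; rewrite !inE.
  apply/and3P => -[mF uF vF]; move: vC.
  by rewrite (subsetP (minfort_connected mF uF)).
have branchC y : y \in branch par v -> y \in component.
  by elim/branch_ind=> // z _; exact: component_par.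
have [c cb [cu pc]] : exists2 c, c \in branch par v & c != u /\ par c = u.
  have [m] := ubnP (d v); elim: m v vu vC {leafv branchC} => // m IH v vu vC dm.
  have [pu|pu] := eqVneq (par v) u; first by exists v; rewrite // branch_refl.
  have [|c cb ?] := IH (par v) pu (component_par vC); first by move: dm; rewrite (dS vu).
  exists c => //; move: cb; rewrite !inE; apply: connect_trans; exact: fconnect1.
have H y : y \in component -> y \notin branch par v -> [/\ v != u, par y != u & par y != v].
  move=> yC yb; have yu : y != u by apply: contraNneq yb => ->; exact: branch_root dS _.
  have yp : adj g y (par y) by apply: adj_p; rewrite // inE in yC.
  split=> //; apply: contraNneq yb => py; rewrite py forest_sym in yp.
    have cC := branchC _ cb; rewrite (leafu y c yp) // forest_sym -pc adj_p //.
    by rewrite inE in cC.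
  rewrite (leafv y (par v) yp) ?branch_par ?branch_refl //.
  by apply: adj_p; rewrite // inE in vC.
apply: leq_trans (leq_trans (card_rforts par_u dS H) _); last first.
  by rewrite -[X in _ <= pad X]card_ord; apply: leq_pad; exact: max_card.
apply: subset_leq_card; apply/subsetP => F; rewrite inE => /and3P[mF uF vF].
by apply/rfortsP; exact: minfort_rfort.
Qed.

End Rooted.

(** * Pairs of leaves in a minimal fort *)

Definition leaf x := [forall y, forall z, adj g x y ==> adj g x z ==> (y == z)].

Lemma leafP x : reflect (forall y z, adj g x y -> adj g x z -> y = z) (leaf x).
Proof.
apply: (iffP idP) => [/forallP h y z|h].
  by move/forallP/(_ z)/implyP: (h y) => H /H /implyP H' /H' /eqP.
by do 2![apply/forallP => ?]; apply/implyP => xy; apply/implyP => /(h _ _ xy) ->.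
Qed.

(** These vertices satisfy [leaf] too; they are set apart because their singletons are minimal forts
    containing no pair of leaves. *)
Definition isolated := [set x | [forall y, ~~ adj g x y]].

Lemma isolated_fort x : x \in isolated -> is_fort g [set x].
Proof.
rewrite inE => /forallP h; apply/andP; split; first by apply/set0Pn; exists x; rewrite set11.
apply/forallP => y; apply/implyP => _.
rewrite (_ : [set u in _ | _] = set0) ?cards0 //; apply/setP => z; rewrite !inE.
by apply/negP => /andP[/eqP ->]; rewrite forest_sym (negPf (h y)).
Qed.

Lemma minfort_leaf F u : is_minimal_fort g F -> u \in F -> F != [set u] ->
  exists x, [/\ x \in F, x != u & leaf x].
Proof.
move=> mF uF Fu; have [par [d r]] := exists_rooting u.
have [x [xF xu xl]] := minfort_leaf_below r mF uF Fu.
by exists x; split=> //; apply/leafP.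
Qed.

(** Rooting at a vertex of [F] yields a leaf [x] in [F], and rooting again at [x] a second one.
    Neither is isolated, since its singleton would be a smaller fort. *)
Lemma minfort_pair F : is_minimal_fort g F ->
  (exists2 x, x \in isolated & F = [set x]) \/
  exists x y, [/\ x \in F :\: isolated, y \in F :\: isolated, x != y, leaf x & leaf y].
Proof.
move=> mF; have fF := minfort_fort mF.
have /set0Pn[u uF] : F != set0 by case/andP: fF.
have [Fu|Fu] := eqVneq F [set u].
  left; exists u => //; rewrite inE; apply/forallP => x; apply/negP => ux.
  have xF : x \notin F by rewrite Fu inE eq_sym forest_neq.
  rewrite forest_sym in ux; have [z []] := fortP fF xF uF ux.
  by rewrite Fu inE => -> .
right; have [x [xF xu xl]] := minfort_leaf mF uF Fu.
have Fx z : F != [set z].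
  apply/eqP => e; move: uF xF; rewrite e !inE => /eqP uz /eqP xz.
  by rewrite xz uz eqxx in xu.
have [y [yF yx yl]] := minfort_leaf mF xF (Fx x).
have niso z : z \in F -> z \in F :\: isolated.
  move=> zF; apply/setDP; split=> //; apply/negP => /isolated_fort.
  by move=> /(minfort_min mF); rewrite sub1set zF => /(_ isT) e; move: (Fx z); rewrite -e eqxx.
by exists x, y; split; rewrite ?niso // eq_sym.
Qed.

(** A minimal fort other than an isolated vertex is charged to a pair of non-isolated leaves inside
    it; the remaining pairs are charged nothing. *)
Lemma nb_min_forts_le : nb_min_forts g <= #|isolated| + 'C(n - #|isolated|, 2) * pad n.
Proof.
pose D := [set A : {set 'I_n} | A \subset ~: isolated & #|A| == 2].
pose S (A : {set 'I_n}) := [set F | [&& is_minimal_fort g F, A \subset F & A \subset leaf]].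
have cD : #|D| = 'C(n - #|isolated|, 2).
  by rewrite cards_draws cardsCs setCK card_ord.
rewrite /nb_min_forts -cD -sum_nat_const.
have cover : [set F | is_minimal_fort g F] \subset
    [set [set x] | x in isolated] :|: \bigcup_(A in D) S A.
  apply/subsetP => F; rewrite inE => mF; apply/setUP.
  have [[x xI ->]|[x [y [/setDP[xF xI] /setDP[yF yI] xy xl yl]]]] := minfort_pair mF.
    by left; apply: imset_f.
  right; apply/bigcupP; exists [set x; y].
    by rewrite inE cards2 xy subUset !sub1set !in_setC xI yI.
  rewrite inE mF !subUset !sub1set xF yF /=; apply/subsetP => z.
  by rewrite !inE => /orP[] /eqP ->.
apply: leq_trans (subset_leq_card cover) _.
apply: leq_trans (leq_card_setU _ _).1 _; apply: leq_add; first exact: leq_imset_card.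
apply: leq_trans (leq_card_bigcup D S) _; apply: leq_sum => A.
rewrite inE => /andP[_ /cards2P[x [y [xy ->]]]].
have [/andP[xl yl]|nl] := boolP (leaf x && leaf y); last first.
  rewrite (_ : S _ = set0) ?cards0 //; apply/setP => F; rewrite !inE.
  apply: contraNF nl => /and3P[_ _ /subsetP h].
  by apply/andP; split; apply: h; rewrite !inE eqxx ?orbT.
have [par [d r]] := exists_rooting x.
have yx : y != x by rewrite eq_sym.
apply: leq_trans (card_minfort_leaves r yx (leafP _ xl) (leafP _ yl)).
apply: subset_leq_card; apply/subsetP => F; rewrite !inE subUset !sub1set.
by case/and3P=> -> /andP[-> ->].
Qed.

End Forest.

(** * Minimal forts of paths *)

Lemma adj_path n (i j : 'I_n) :
  adj (path_graph n) i j = (i.+1 == j :> nat) || (j.+1 == i :> nat).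
Proof. by rewrite /adj inE. Qed.

(** A missing vertex has both its neighbours in the set, so this is a fort. A fort inside it must
    contain vertex 0, and from there membership is forced from left to right. *)
Lemma path_minfort n (f : nat -> bool) : 0 < n -> f 0 -> f n.-1 ->
  (forall i, i.+1 < n -> f i || f i.+1) ->
  (forall i, i.+2 < n -> ~~ [&& f i, f i.+1 & f i.+2]) ->
  is_minimal_fort (path_graph n) [set i : 'I_n | f i].
Proof.
move=> n0 f0 fn f2 f3; set F := [set i : 'I_n | f i].
apply/andP; split.
  apply/andP; split; first by apply/set0Pn; exists (Ordinal n0); rewrite inE.
  apply/forallP => i; apply/implyP; rewrite inE => fi.
  case: i fi => -[|i] lti /= fi; first by rewrite f0 in fi.
  have lt2 : i.+2 < n.
    rewrite ltn_neqAle lti andbT; apply: contraNneq fi => ni; by rewrite -ni in fn.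
  have fpred : f i by have := f2 i lti; rewrite (negPf fi) orbF.
  have fsucc : f i.+2 by have := f2 i.+1 lt2; rewrite (negPf fi).
  rewrite neq_ltn; apply/orP; right; apply/card_gt1P.
  exists (Ordinal (ltnW lti)), (Ordinal lt2).
  split; last by apply/eqP => /(congr1 val) /=; lia.
    by rewrite !inE adj_path /= fpred eqxx orbT.
  by rewrite !inE adj_path /= fsucc eqxx.
apply/forallP => F'; apply/implyP => /properP[sF [x xF xF']]; apply/negP => fF'.
pose prv (i : 'I_n) := Ordinal (leq_ltn_trans (leq_pred i) (ltn_ord i)).
(* If vertex 0 is missing, [F'] is empty: its first vertex would be the only neighbour in [F'] of
   its predecessor. *)
have z0 : Ordinal n0 \in F'.
  have /set0Pn[y yF'] : F' != set0 by case/andP: fF'.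
  apply: contraTT yF' => z0; have [k] := ubnP (y : nat); elim: k y => // k IH y yk.
  have [y0|y0] := posnP (y : nat); first by rewrite (_ : y = Ordinal n0) //; exact: val_inj.
  apply/negP => yF'; have pF' : prv y \notin F' by apply: IH => /=; clear - yk y0; lia.
  have [|z [zF']] := fortP fF' pF' yF'; first by rewrite adj_path /= prednK ?eqxx.
  rewrite adj_path /= prednK // => /orP[/eqP yz|/eqP zy]; first by move/eqP; case; apply: val_inj.
  by have /negP[] : z \notin F' by apply: IH; clear - zy yk; lia.
suff /subsetP/(_ x xF) : F \subset F' by rewrite (negPf xF').
apply/subsetP => y; have [k] := ubnP (y : nat); elim: k y {x xF xF'} => // k IH y yk yF.
have [y0|y0] := posnP (y : nat); first by rewrite (_ : y = Ordinal n0) //; exact: val_inj.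
apply/negPn/negP => yF'.
have IHp (z : 'I_n) : z < y -> f z -> z \in F'.
  by move=> zy fz; apply: IH; [clear - zy yk; lia | rewrite inE].
have adjp : adj (path_graph n) y (prv y) by rewrite adj_path /= prednK ?eqxx ?orbT.
have fy : f y by rewrite inE in yF.
(* If the predecessor of [y] is in [F'] and [y] is not, the successor of [y] must be, and [F] has
   three consecutive vertices. *)
have [fp|fp] := boolP (f y.-1).
  have pF' : prv y \in F' by apply: IHp; rewrite //= ltn_predL.
  have [z [zF']] := fortP fF' yF' pF' adjp.
  rewrite adj_path => /orP[/eqP yz|/eqP zy] nz; last first.
    by case/eqP: nz; apply: val_inj; rewrite /= -zy.
  have := subsetP sF _ zF'; rewrite inE => fz.
  have := f3 y.-1; rewrite prednK // yz fp fy fz => /(_ (ltn_ord z)); done.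
(* If the predecessor is missing, it sees the vertex before it in [F'], so its other neighbour [y]
   must be in [F']. *)
have pF' : prv y \notin F' by apply: contra fp => /(subsetP sF); rewrite inE.
have y1 : 0 < y.-1 by rewrite lt0n; apply: contraNneq fp => ->.
have fpp : f y.-2.
  have := f2 y.-2; rewrite prednK // (negPf fp) orbF; apply.
  exact: leq_ltn_trans (leq_pred _) (ltn_ord _).
have ppF' : prv (prv y) \in F'.
  by apply: IHp; rewrite //= (leq_ltn_trans (leq_pred _)) // ltn_predL.
have [|z [zF']] := fortP fF' pF' ppF'; first by rewrite adj_path /= (prednK y1) eqxx orbT.
rewrite adj_path /= prednK // => /orP[/eqP yz|/eqP zy] nz.
  by case/negP: yF'; rewrite (_ : y = z) //; apply: val_inj.
by case/eqP: nz; apply: val_inj; rewrite /= -zy.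
Qed.

(* Characteristic words of sets containing both ends of the path, with no two
consecutive vertices outside and no three consecutive vertices inside. *)
Fixpoint words (n : nat) : seq (seq bool) :=
  match n with
  | 0 => [::]
  | 1 => [:: [:: true]]
  | 2 => [:: [:: true; true]]
  | (m.+1 as q).+2 =>
      [seq true :: false :: w | w <- words q] ++
      [seq true :: true :: false :: w | w <- words m]
  end.

Lemma size_words n : size (words n) = pad n.
Proof.
elim/nat_ind3: n => // n h0 h1 _.
by rewrite padS3 -h0 -h1 [words n.+3]/= size_cat !size_map.
Qed.

Lemma uniq_words n : uniq (words n).
Proof.
elim/nat_ind3: n => // n h0 h1 _; rewrite [words n.+3]/= cat_uniq.
rewrite !map_inj_uniq ?h0 ?h1 ?andbT //=; try by move=> ? ? [].
by apply/hasPn => _ /mapP[w _ ->]; apply/mapP => -[].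
Qed.

(** Words begin with [true], so neither prefix creates two consecutive [false] or three consecutive
    [true]. *)
Lemma wordsP n w : w \in words n ->
  [/\ size w = n, nth false w 0, nth false w n.-1,
      forall i, i.+1 < n -> nth false w i || nth false w i.+1 &
      forall i, i.+2 < n -> ~~ [&& nth false w i, nth false w i.+1 & nth false w i.+2]].
Proof.
elim/nat_ind3: n w => [|||n IH0 IH1 _] w //.
- by rewrite inE => /eqP ->.
- by rewrite inE => /eqP ->; split=> // -[].
rewrite [words _]/= mem_cat => /orP[] /mapP[w' /[dup] w'n].
  case/IH1=> s h0 hl h2 h3 ->; split; rewrite //= ?s //.
    by case=> [|[|i]] //=; exact: h2.
  by case=> [|[|i]] //=; exact: h3.
case: n IH0 IH1 w'n => // n IH0 _ _ /IH0[s h0 hl h2 h3 ->]; split; rewrite //= ?s //.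
  by case=> [|[|[|i]]] //=; exact: h2.
by case=> [|[|[|i]]] //=; exact: h3.
Qed.

Lemma pad_leq_FP n : 0 < n -> pad n <= FP n.
Proof.
move=> n0; pose S (w : seq bool) := [set i : 'I_n | nth false w i].
rewrite -size_words -(size_map S) /FP /nb_min_forts cardE.
apply: uniq_leq_size.
  rewrite map_inj_in_uniq ?uniq_words // => w w' /wordsP[s _ _ _ _] /wordsP[s' _ _ _ _] e.
  apply: (@eq_from_nth _ false); rewrite s ?s' // => i lti.
  by move/setP/(_ (Ordinal lti)): e; rewrite !inE.
move=> _ /mapP[w /wordsP[_ h0 hl h2 h3] ->]; rewrite mem_enum inE.
exact: path_minfort.
Qed.

(** * The two inequalities *)

Lemma FT_leq_FR n : FT n <= FR n.
Proof.
apply/bigmax_leqP => g /andP[gf _]; exact: leq_bigmax_cond.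
Qed.

(** Each vertex added to a nonempty set creates at least one new pair, which pays for one isolated
    vertex. *)
Lemma bin2_isolated n k P : 3 <= n -> k <= n -> 0 < P ->
  k + 'C(n - k, 2) * P <= 'C(n, 2) * P.
Proof.
move=> n3 kn P0; suff h : k + 'C(n - k, 2) <= 'C(n, 2).
  by apply: leq_trans (leq_mul h (leqnn P)); rewrite mulnDl leq_add2r leq_pmulr.
rewrite -{2}(subnK kn); move: (subnK kn); move: (n - k) => m mk.
have step a b : 0 < a -> b + 'C(a, 2) <= 'C(a + b, 2).
  move=> a0; elim: b => [|b IH]; first by rewrite addn0.
  rewrite addnS binS bin1; lia.
case: m mk => [|m] mk; last by rewrite step.
(* When all vertices are isolated, the comparison starts from 'C(3, 2) = 3, which uses [3 <= n]. *)
rewrite add0n in mk *; rewrite addn0 mk.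
by have := step 3 (n - 3) isT; rewrite subnKC // (_ : 'C(3, 2) = 3) // subnK.
Qed.

Theorem theorem1 (n : nat) : 3 <= n -> FT n <= FR n <= 'C(n, 2) * FP n.
Proof.
move=> n3; rewrite FT_leq_FR /=; have n0 : 0 < n by exact: leq_trans n3.
apply/bigmax_leqP => g fg; apply: leq_trans (nb_min_forts_le fg) _.
apply: leq_trans (leq_mul (leqnn _) (pad_leq_FP n0)).
apply: bin2_isolated => //; last exact: pad_gt0.
by rewrite -[X in _ <= X]card_ord; exact: max_card.
Qed.
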